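(* As formal power series in $z$ and $q$, where $q$ records the weight and $z$ records the number of parts, $$\sum_{\lambda\in\mathcal{P}_{\mathrm{pal}}}z^{\ell(\lambda)}q^{|\lambda|}=1+\sum_{m\ge 0}\frac{z^{2m+1}q^{2m+1}}{(1-q^{2m+1})^{m+1}}+\sum_{m\ge 1}\frac{z^{2m}q^{2m}}{(1-q^{2m})^{m}(1-q^{m})}.$$
   Context: A partition is a finite sequence $\lambda=(\lambda_1,\dots,\lambda_\ell)$ of positive integers written in non-decreasing order $\lambda_1\le\cdots\le\lambda_\ell$ (the empty partition, $\ell=0$, is allowed). Its length (number of parts) is $\ell(\lambda)=\ell$ and its weight is $|\lambda|=\lambda_1+\cdots+\lambda_\ell$. A partition $\lambda$ is a palindromic-gap partition if $\lambda_{i+1}-\lambda_i=\lambda_{\ell-i+1}-\lambda_{\ell-i}$ for all $1\le i\le \ell-1$; the empty partition and all one-part partitions satisfy this vacuously. $\mathcal{P}_{\mathrm{pal}}$ is the set of all palindromic-gap partitions (including the empty partition). *)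

(* Defs.v *)
From HB Require Import structures.
From mathcomp Require Import all_boot all_order all_algebra.
From mathcomp Require Import boolp classical_sets cardinality fsbigop.

Set Implicit Arguments.
Unset Strict Implicit.
Unset Printing Implicit Defensive.

Import GRing.Theory.
Local Open Scope classical_set_scope.
Local Open Scope ring_scope.

(** * The ring of formal power series R[[X]] *)

Record fps (R : Type) := Fps { fps_coef : nat -> R }.

HB.instance Definition _ (R : Type) := gen_eqMixin (fps R).
HB.instance Definition _ (R : Type) := gen_choiceMixin (fps R).

Lemma fpsP (R : Type) (f g : fps R) : fps_coef f =1 fps_coef g -> f = g.
Proof. by case: f g => [f] [g] /funext /= ->. Qed.

Section FpsRing.
Variable R : comNzRingType.
Implicit Types f g h : fps R.

Definition fps0 : fps R := Fps (fun=> 0).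
Definition fpsN f : fps R := Fps (fun n => - fps_coef f n).
Definition fpsD f g : fps R := Fps (fun n => fps_coef f n + fps_coef g n).

Let fpsDA : associative fpsD.
Proof. by move=> f g h; apply: fpsP => n /=; rewrite addrA. Qed.
Let fpsDC : commutative fpsD.
Proof. by move=> f g; apply: fpsP => n /=; rewrite addrC. Qed.
Let fps0D : left_id fps0 fpsD.
Proof. by move=> f; apply: fpsP => n /=; rewrite add0r. Qed.
Let fpsND : left_inverse fps0 fpsN fpsD.
Proof. by move=> f; apply: fpsP => n /=; rewrite addNr. Qed.

HB.instance Definition _ :=
  GRing.isZmodule.Build (fps R) fpsDA fpsDC fps0D fpsND.

Definition fpsC (c : R) : fps R := Fps (fun n => if n == 0%N then c else 0).
Definition fpsX : fps R := Fps (fun n => (n == 1%N)%:R).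
Definition fpsM f g : fps R :=
  Fps (fun n => \sum_(i < n.+1) fps_coef f i * fps_coef g (n - i)).

Let fpsMC : commutative fpsM.
Proof.
move=> f g; apply: fpsP => n /=; rewrite (reindex_inj rev_ord_inj) /=.
by apply: eq_bigr => i _; rewrite subSS subKn ?leq_ord // mulrC.
Qed.

Let trunc n f : {poly R} := \poly_(i < n.+1) fps_coef f i.

Let truncM n i f g : (i <= n)%N ->
  fps_coef (fpsM f g) i = (trunc n f * trunc n g)`_i.
Proof.
move=> le_in; rewrite coefM /=; apply: eq_bigr => j _.
have le_jn : (j <= n)%N by apply: leq_trans le_in; rewrite -ltnS.
by rewrite !coef_poly !ltnS le_jn (leq_trans (leq_subr _ _) le_in).
Qed.

Let fpsMA : associative fpsM.
Proof.
move=> f g h; apply: fpsP => n.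
have -> : fps_coef (fpsM f (fpsM g h)) n
          = (trunc n f * (trunc n g * trunc n h))`_n.
  rewrite coefM /=; apply: eq_bigr => j _.
  rewrite coef_poly ltn_ord; congr (_ * _).
  by rewrite -(@truncM n) ?leq_subr.
rewrite mulrA coefM; apply: eq_bigr => j _.
by rewrite (@truncM n) -1?ltnS // coef_poly ltnS leq_subr.
Qed.

Let fps1M : left_id (fpsC 1) fpsM.
Proof.
move=> f; apply: fpsP => n /=; rewrite big_ord_recl /= mul1r subn0.
by rewrite big1 ?addr0 // => i _; rewrite mul0r.
Qed.

Let fpsMDl : left_distributive fpsM +%R.
Proof.
move=> f g h; apply: fpsP => n /=; rewrite -big_split /=.
by apply: eq_bigr => i _; rewrite mulrDl.
Qed.

Let fps1_neq0 : fpsC 1 != 0.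
Proof.
by apply/eqP => /(congr1 (fun f => fps_coef f 0)) /= /eqP; rewrite oner_eq0.
Qed.

HB.instance Definition _ :=
  GRing.Zmodule_isComNzRing.Build (fps R) fpsMA fpsMC fps1M fpsMDl fps1_neq0.

(* Units are the series having a multiplicative inverse, and [fps_inv f] is
   that inverse; as everywhere in MathComp, [f^-1 = f] for a non-unit [f]. *)
Definition fps_unit : {pred fps R} := fun f => `[< exists g, g * f = 1 >].
Definition fps_inv f : fps R := xget f [set g | g * f = 1].

Let fps_mulVf : {in fps_unit, left_inverse 1 fps_inv *%R}.
Proof. by move=> f /asboolP[g gf]; rewrite /fps_inv; case: xgetP => // /(_ g). Qed.
Let fps_unitPl f g : g * f = 1 -> fps_unit f.
Proof. by move=> gf; apply/asboolP; exists g. Qed.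
Let fps_invr_out : {in [predC fps_unit], fps_inv =1 id}.
Proof.
move=> f /asboolP nf; rewrite /fps_inv; case: xgetP => // g _ gf.
by case: nf; exists g.
Qed.

HB.instance Definition _ := GRing.ComNzRing_hasMulInverse.Build (fps R)
  fps_mulVf fps_unitPl fps_invr_out.

Lemma fpsC_is_zmod_morphism : zmod_morphism fpsC.
Proof. by move=> a b; apply: fpsP => -[|n] //=; rewrite oppr0 addr0. Qed.

Lemma fpsC_is_monoid_morphism : monoid_morphism fpsC.
Proof.
split=> // a b; apply: fpsP => -[|n] /=; first by rewrite big_ord1.
rewrite big1 // => -[[|i] lt_in] _ /=; last by rewrite mul0r.
by rewrite mulr0.
Qed.

HB.instance Definition _ :=
  GRing.isZmodMorphism.Build R (fps R) fpsC fpsC_is_zmod_morphism.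
HB.instance Definition _ :=
  GRing.isMonoidMorphism.Build R (fps R) fpsC fpsC_is_monoid_morphism.

Lemma coef_fpsXnM k f n :
  fps_coef (fpsX ^+ k * f) n = if (k <= n)%N then fps_coef f (n - k) else 0.
Proof.
elim: k n => [|k IHk] n; first by rewrite expr0 mul1r subn0.
rewrite exprS -mulrA; case: n => [|n]; first by rewrite /= big_ord1 mul0r.
rewrite [LHS]/= big_ord_recl big_ord_recl /= mul0r add0r mul1r subn1.
rewrite [X in _ + X]big1 => [|i _]; last by rewrite mul0r.
by rewrite addr0 ltnS subSS; apply: IHk.
Qed.

Lemma unit_1subXn k : (0 < k)%N -> 1 - fpsX ^+ k \is a GRing.unit.
Proof.
move=> k_gt0; pose g : fps R := Fps (fun n => (k %| n)%N%:R).
apply/asboolP; exists g; rewrite mulrBr mulr1 [g * _]mulrC.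
have coefB f h n : fps_coef (f - h) n = fps_coef f n - fps_coef h n by [].
apply: fpsP => n; rewrite coefB coef_fpsXnM /=.
case: leqP => [le_kn | lt_nk].
  have -> : (k %| n - k)%N = (k %| n)%N by rewrite dvdn_subl.
  by rewrite subrr; case: n le_kn => //; case: k k_gt0 {g}.
rewrite subr0; case: n lt_nk => [|n] lt_nk; first by rewrite dvdn0.
by rewrite gtnNdvd.
Qed.

End FpsRing.

(** * Z[[z, q]], as Z[[q]][[z]] *)

Notation fps_zq := (fps (fps int)).

Definition z : fps_zq := fpsX (fps int).
Definition q : fps_zq := fpsC (fpsX int).

Definition coef_zq (f : fps_zq) (i j : nat) : int :=
  fps_coef (fps_coef f i) j.

Lemma unit_1subq (k : nat) : (0 < k)%N -> 1 - q ^+ k \is a GRing.unit.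
Proof.
move=> k_gt0; rewrite /q -rmorphXn -(rmorph1 (@fpsC (fps int))) -rmorphB.
by apply: rmorph_unit; apply: unit_1subXn.
Qed.

(* Sum of a family of series, taken coefficientwise.  It is meaningful only for
   a family which is [summable_zq]: the finitely supported sum [\sum_(k \in A)]
   is 0 by convention when the support is infinite. *)
Definition summable_zq (I : choiceType) (A : set I) (F : I -> fps_zq) : Prop :=
  forall i j, finite_set (A `&` [set k | coef_zq (F k) i j != 0]).

Definition sum_zq (I : choiceType) (A : set I) (F : I -> fps_zq) : fps_zq :=
  Fps (fun i => Fps (fun j => \sum_(k \in A) coef_zq (F k) i j)).

(** * Partitions *)

Definition is_partition (s : seq nat) : bool :=
  sorted leq s && all (leq 1) s.

(* The parts of [s], numbered from 1. *)
Definition part (s : seq nat) (i : nat) : nat := nth 0%N s i.-1.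

(* The differences are those of a non-decreasing sequence, hence the truncated
   subtraction of [nat] agrees with that of the integers. *)
Definition palindromic_gap (s : seq nat) : Prop :=
  forall i, (1 <= i <= size s - 1)%N ->
    (part s i.+1 - part s i
     = part s (size s - i + 1) - part s (size s - i))%N.

Definition Ppal : set (seq nat) :=
  [set s | is_partition s /\ palindromic_gap s].

(* Main.v *)
Require Import Defs.
From mathcomp Require Import all_boot all_order all_algebra.
From mathcomp Require Import boolp classical_sets functions cardinality fsbigop.
From mathcomp Require Import zify ring.

Set Implicit Arguments.
Unset Strict Implicit.
Unset Printing Implicit Defensive.

Import GRing.Theory.
Local Open Scope classical_set_scope.
Local Open Scope ring_scope.

(** Write [s_0 <= ... <= s_(n-1)] for a partition with [n > 0] parts.  Its gaps
form a palindrome exactly when the sums [s_i + s_(n-1-i)] all have the same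
value [C] ([palindromic_gap_mirror]), and then its weight is [n * C / 2].  Put
[h = n./2].  The first [h + 1] parts determine [C = s_h + s_(n-1-h)] and hence,
by reflection, all the other parts; conversely every weakly increasing sequence
of [h + 1] positive integers extends to a palindromic-gap partition
([take_half_bij]).  In terms of this half the weight is a linear form: it is
[n * s_h] if [n] is odd, where the centre of the reflection is the part [s_h],
and [h * s_(h-1) + h * s_h] if [n] is even.

It remains to count weakly increasing sequences [1 <= t_0 <= ... <= t_k] by a
linear weight [a_0 t_0 + ... + a_k t_k].  If [t_0 = 1], then removing [t_0]
leaves such a sequence for [a_1, ..., a_k]; if [t_0 > 1], then lowering all the
entries by 1 lowers the weight by [A_0 = a_0 + ... + a_k].  Therefore the
generating function [G] satisfies
[(1 - X^A_0) G(a_0, ..., a_k) = X^a_0 G(a_1, ..., a_k)] ([chain_gf_cons]), so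
each entry contributes a factor [X^a_i / (1 - X^A_i)], where
[A_i = a_i + ... + a_k].  For the weights above the suffix sums [A_i] are [n]
taken [h + 1] times if [n] is odd, and [n] taken [h] times and then [h] if [n]
is even; the exponents [a_i] add up to [n].  This gives the two kinds of terms
of the theorem, and the term 1 is the empty partition. *)

(** * Weakly increasing sequences with a linear weight *)

Definition dot (a t : seq nat) : nat := sumn [seq (p.1 * p.2)%N | p <- zip a t].

Definition chains (a : seq nat) (n : nat) : set (seq nat) :=
  [set t | [/\ size t = size a, path leq 1 t & dot a t = n]].

Definition chain_gf (a : seq nat) : fps int :=
  Fps (fun n => \sum_(t \in chains a n) (1 : int)).

Lemma dot_map_succ a t :
  size t = size a -> dot a (map S t) = (sumn a + dot a t)%N.
Proof.
elim: a t => [|x a IHa] [|y t] //= [/IHa]; rewrite /dot /= => ->; lia.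
Qed.

Lemma path_map_succ t : path leq 1 t -> path leq 1 (map S t).
Proof.
case: t => //= y t /andP[_ t_path]; rewrite path_map.
by rewrite (eq_path (e' := leq)) // => i j; rewrite /= ltnS.
Qed.

(** Either the first entry is 1, or all the entries can be lowered by 1, which
lowers the weight by the sum of all the coefficients. *)
Lemma chains_cons x a n :
  chains (x :: a) n =
    (if (x <= n)%N then cons 1%N @` chains a (n - x) else set0) `|`
    (if (sumn (x :: a) <= n)%N
     then map S @` chains (x :: a) (n - sumn (x :: a)) else set0).
Proof.
apply/seteqP; split => [t|t [|]].
- case: t => [[]//|y t] [] [] size_t /= /andP[y_gt0 t_path] t_dot.
  have [y1|y_neq1] := eqVneq y 1%N.
    left; rewrite {}y1 in t_path t_dot *.
    rewrite /dot /= muln1 -/(dot a t) in t_dot.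
    rewrite -t_dot leq_addr; exists t => //; split=> //; lia.
  right; pose S' := sumn (x :: a); rewrite -[(x + sumn a)%N]/S'.
  have y_min : all (leq y) t by apply: order_path_min t_path; apply: leq_trans.
  have def_t : y :: t = map S (map predn (y :: t)).
    rewrite -map_comp -[LHS]map_id; apply/eq_in_map => v; rewrite inE /=.
    by case/predU1P=> [->|/(allP y_min)]; lia.
  have p_path : path leq 1 (map predn (y :: t)).
    rewrite /=; apply/andP; split; first lia.
    by rewrite path_map; apply: sub_path t_path => i j /=; lia.
  have p_dot : dot (x :: a) (y :: t) = (S' + dot (x :: a) (map predn (y :: t)))%N.
    by rewrite [in LHS]def_t dot_map_succ //= size_map size_t.
  rewrite -t_dot p_dot leq_addr; exists (map predn (y :: t)) => //.
  by split; rewrite ?addKn //= size_map size_t.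
- case: leqP => // le_xn [u [size_u u_path u_dot] <-].
  split=> //=; first by rewrite size_u.
  by rewrite /dot /= -/(dot a u) u_dot; lia.
- case: leqP => // le_Sn [u [size_u u_path u_dot] <-].
  split; first by rewrite size_map.
    exact: path_map_succ.
  by rewrite dot_map_succ // u_dot subnKC.
Qed.

Lemma sumn_gt0 a : a != [::] -> (0 < last 1 a)%N -> (0 < sumn a)%N.
Proof.
case/lastP: a => // a x _; rewrite last_rcons sumn_rcons; lia.
Qed.

Lemma last_behead x a : (0 < last 1 (x :: a))%N -> (0 < last 1 a)%N.
Proof. by case: a. Qed.

Lemma chains_nil n : chains [::] n = if n == 0%N then [set [::]] else set0.
Proof.
case: eqP => [->|n_neq0]; apply/seteqP; split=> t //=.
- by case=> /size0nil.
- by move=> ->.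
- by case=> /size0nil -> _ /esym.
Qed.

(** A positive last coefficient bounds the largest entry; in the induction it
makes [sumn (x :: a)] positive, so that lowering all the entries reduces the
weight.  For [a = [::]] the default value 1 makes the hypothesis hold. *)
Lemma finite_chains a n : (0 < last 1 a)%N -> finite_set (chains a n).
Proof.
elim: a n => [|x a IHa] n a_last; first by rewrite chains_nil; case: eqP.
have S_gt0 : (0 < sumn (x :: a))%N by apply: sumn_gt0.
elim/ltn_ind: n => n IHn; rewrite chains_cons finite_setU; split; case: leqP => // le_n.
  by apply/finite_image/IHa/last_behead/a_last.
by apply/finite_image/IHn; lia.
Qed.

Lemma chain_gf_nil : chain_gf [::] = 1.
Proof.
apply: fpsP => n /=; rewrite chains_nil.
by case: eqP => _; rewrite (fsbig_set1, fsbig_set0).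
Qed.

(** The two alternatives of [chains_cons] contribute [X^x * chain_gf a] and
[X^(sumn (x :: a)) * chain_gf (x :: a)] to [chain_gf (x :: a)]. *)
Lemma chain_gf_cons x a : (0 < last 1 (x :: a))%N ->
  (1 - fpsX int ^+ sumn (x :: a)) * chain_gf (x :: a)
  = fpsX int ^+ x * chain_gf a.
Proof.
move=> a_last; have S_gt0 : (0 < sumn (x :: a))%N by apply: sumn_gt0.
rewrite mulrBl mul1r; apply/eqP; rewrite subr_eq; apply/eqP.
apply: fpsP => n.
rewrite [RHS](_ : _ = fps_coef (fpsX int ^+ x * chain_gf a) n +
  fps_coef (fpsX int ^+ sumn (x :: a) * chain_gf (x :: a)) n) //.
rewrite !coef_fpsXnM; cbn [chain_gf fps_coef]; rewrite [in LHS]chains_cons.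
have fin b k : (0 < last 1 b)%N -> forall f : seq nat -> seq nat,
    finite_set (f @` chains b k).
  by move=> b_last f; apply/finite_image/finite_chains.
have a_last' := last_behead a_last.
rewrite fsbigU0; first last.
- move=> t []; case: leqP => // _ [u _ <-]; case: leqP => // _ [] [|v w] [] //.
  by move=> _ /= /andP[v_gt0 _] _ []; lia.
- by case: leqP => // _; apply: fin.
- by case: leqP => // _; apply: fin.
congr (_ + _); case: leqP => // _; rewrite ?fsbig_set0 // fsbig_image //.
  by move=> u v _ _ [].
by move=> u v _ _; apply: inj_map => i j [].
Qed.

(** A leading coefficient 0 leaves the total [sumn a] unchanged, so each one
contributes the same denominator, with numerator 1. *)
Lemma chain_gf_nseq k a : a != [::] -> (0 < last 1 a)%N ->
  (1 - fpsX int ^+ sumn a) ^+ k * chain_gf (nseq k 0%N ++ a) = chain_gf a.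
Proof.
move=> a_neq0 a_last; elim: k => [|k IHk]; first by rewrite mul1r.
have sum_pad : sumn (0%N :: nseq k 0%N ++ a) = sumn a.
  by rewrite /= sumn_cat sumn_nseq.
have := @chain_gf_cons 0 (nseq k 0%N ++ a).
rewrite sum_pad mul1r exprSr -mulrA => -> //.
by case: a a_neq0 a_last {IHk sum_pad} => //= x a _; rewrite last_cat.
Qed.

(** * The weight carried by one half of a palindromic-gap partition *)

(** The coefficients of the weight of a partition of length [n > 0] as a linear
form in its first [n./2 + 1] parts: the reflection that exchanges the parts
[i] and [n - 1 - i] fixes a part if [n] is odd, and exchanges two consecutive
ones if [n] is even. *)
Definition half_weights (n : nat) : seq nat :=
  nseq n.-1./2 0%N ++ (if odd n then [:: n] else [:: n./2; n./2]).

Lemma size_half_weights n : (0 < n)%N -> size (half_weights n) = n./2.+1.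
Proof. by rewrite /half_weights size_cat size_nseq; case: ifP => /=; lia. Qed.

Lemma last_half_weights n : (0 < n)%N -> (0 < last 1 (half_weights n))%N.
Proof. by rewrite /half_weights last_cat; case: ifP => /=; lia. Qed.

Lemma chain_gf1 n : (0 < n)%N ->
  (1 - fpsX int ^+ n) * chain_gf [:: n] = fpsX int ^+ n.
Proof.
move=> n_gt0; have := @chain_gf_cons n [::] n_gt0.
by rewrite chain_gf_nil mulr1 [sumn _]addn0.
Qed.

Lemma chain_gf_odd m :
  (1 - fpsX int ^+ (2 * m + 1)) ^+ (m + 1) * chain_gf (half_weights (2 * m + 1))
  = fpsX int ^+ (2 * m + 1).
Proof.
have n_gt0 : (0 < 2 * m + 1)%N by lia.
have -> : half_weights (2 * m + 1) = nseq m 0%N ++ [:: 2 * m + 1]%N.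
  by rewrite /half_weights ifT; [congr (nseq _ _ ++ _)|]; lia.
move: (2 * m + 1)%N n_gt0 => n n_gt0.
have := @chain_gf_nseq m [:: n] isT n_gt0; rewrite [sumn _]addn0 => gf_pad.
by rewrite addn1 exprS -mulrA gf_pad chain_gf1.
Qed.

Lemma chain_gf_even m : (0 < m)%N ->
  (1 - fpsX int ^+ (2 * m)) ^+ m * (1 - fpsX int ^+ m)
    * chain_gf (half_weights (2 * m))
  = fpsX int ^+ (2 * m).
Proof.
case: m => // k _.
have -> : half_weights (2 * k.+1) = nseq k 0%N ++ [:: k.+1; k.+1].
  rewrite /half_weights ifF; last by lia.
  by congr (nseq _ _ ++ [:: _; _]); lia.
have := @chain_gf_nseq k [:: k.+1; k.+1] isT isT.
have := @chain_gf_cons k.+1 [:: k.+1] isT.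
have -> : sumn [:: k.+1; k.+1] = (2 * k.+1)%N by rewrite /=; lia.
have := @chain_gf1 k.+1 isT.
rewrite [(1 - _) ^+ k.+1]exprS.
have -> : fpsX int ^+ (2 * k.+1) = fpsX int ^+ k.+1 * fpsX int ^+ k.+1.
  by rewrite -exprD addnn mul2n.
move: (1 - fpsX int ^+ k.+1) (1 - _ * _) => v u gf1 gf2 gfk.
have -> (p g : fps int) : u * p * v * g = v * (u * (p * g)) by ring.
by rewrite gfk gf2 [LHS]mulrCA gf1.
Qed.

(** * Palindromic gaps and reflection *)

Definition mirror (s : seq nat) (C : nat) : Prop :=
  forall i, (i < size s)%N ->
    (nth 0 s i + nth 0 s (size s - i.+1) = C)%N.

(** Equality of the gaps at the places [i] and [size s - i] says that the sum of
two opposite parts does not change from one pair to the next. *)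
Lemma palindromic_gap_mirror s : sorted leq s ->
  palindromic_gap s <-> exists C, mirror s C.
Proof.
move=> s_sorted.
have le_nth i : (i.+1 < size s)%N -> (nth 0 s i <= nth 0 s i.+1)%N.
  move=> lt_i; apply: (sorted_leq_nth leq_trans leqnn 0%N s_sorted) => //.
  exact: ltnW.
split=> [s_gap|[C s_mir] i /andP[i_gt0 le_i]].
  exists (nth 0 s 0 + nth 0 s (size s).-1)%N; elim=> [|i IHi] lt_i.
    by rewrite subn1.
  rewrite -(IHi (ltnW lt_i)).
  have := s_gap i.+1; rewrite /part /= addn1 /=.
  have -> : (size s - i.+1 = (size s - i.+2).+1)%N by lia.
  have := le_nth i lt_i; have := le_nth (size s - i.+2)%N.
  by rewrite /=; lia.
case: i i_gt0 le_i => // i _ le_i; rewrite /part /= addn1 /=.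
have := s_mir i; have := s_mir i.+1.
have -> : (size s - i.+1 = (size s - i.+2).+1)%N by lia.
have := le_nth i; have := le_nth (size s - i.+2)%N.
by rewrite /=; lia.
Qed.

(** Gauss's trick: add the sequence to its own reversal. *)
Lemma sumn_mirror s C : mirror s C -> (2 * sumn s = size s * C)%N.
Proof.
move=> s_mir; rewrite mul2n -addnn sumnE (big_nth 0%N) big_mkord.
rewrite {2}(reindex_inj rev_ord_inj) -big_split /=.
rewrite (eq_bigr (fun=> C)) => [|i _]; last exact: s_mir.
by rewrite sum_nat_const card_ord.
Qed.

Lemma dot_nseq0 k a t : dot (nseq k 0%N ++ a) t = dot a (drop k t).
Proof.
elim: k t => [|k IHk] [|y t] //=; first by rewrite /dot; case: a {IHk}.
by rewrite -IHk /dot.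
Qed.

(** The two indices [n./2] and [n - n./2.+1] are exchanged by the reflection and
lie in the first half; they coincide when [n] is odd.  Hence this formula has
no case distinction, and it matches [sumn_mirror]. *)
Lemma dot_half_weights n t : (0 < n)%N -> size t = n./2.+1 ->
  (2 * dot (half_weights n) t = n * (nth 0 t n./2 + nth 0 t (n - n./2.+1)))%N.
Proof.
move=> n_gt0 size_t; rewrite /half_weights dot_nseq0.
case: ifP => odd_n.
  rewrite (drop_nth 0%N) /dot /=; last lia.
  have -> : (n - n./2.+1 = n./2)%N by lia.
  have -> : n.-1./2 = n./2 by lia.
  by rewrite drop_oversize ?size_t //=; nia.
rewrite (drop_nth 0%N) ?size_t; last lia.
rewrite (drop_nth 0%N) ?size_t; last lia.
rewrite drop_oversize ?size_t; last lia.
have -> : (n - n./2.+1 = n.-1./2)%N by lia.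
have -> : n.-1./2.+1 = n./2 by lia.
rewrite /dot /=.
have {3}-> : n = (2 * n./2)%N by lia.
nia.
Qed.

(** * Palindromic-gap partitions of given length and weight *)

Definition pal_slice (n j : nat) : set (seq nat) :=
  [set s | [/\ Ppal s, size s = n & sumn s = j]].

Lemma is_partition_path s : is_partition s = path leq 1 s.
Proof.
rewrite /is_partition; case: s => //= x s; rewrite andbC -andbA.
case: leqP => //= x_gt0; case s_path: path; rewrite (andbF, andbT) //.
by apply: sub_all (order_path_min leq_trans s_path) => y; apply: leq_trans.
Qed.

(** The inverse of [take n./2.+1]: the sum of the two central entries is the
common sum of opposite parts, which forces the second half. *)
Definition unfold_half (n : nat) (t : seq nat) : seq nat :=
  mkseq (fun i => if (i <= n./2)%N then nth 0 t i
                  else nth 0 t n./2 + nth 0 t (n - n./2.+1) - nth 0 t (n - i.+1))%N n.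

Lemma sumn_half n s C : (0 < n)%N -> size s = n -> mirror s C ->
  sumn s = dot (half_weights n) (take n./2.+1 s).
Proof.
move=> n_gt0 size_s s_mir; have := sumn_mirror s_mir.
have := @dot_half_weights n (take n./2.+1 s) n_gt0.
rewrite size_takel; last by rewrite size_s; lia.
rewrite !nth_take; [|lia..].
have := s_mir n./2; rewrite size_s => ->; last lia.
by move=> /(_ erefl); lia.
Qed.

Lemma take_half_inj n s1 s2 C1 C2 : (0 < n)%N ->
  size s1 = n -> size s2 = n -> mirror s1 C1 -> mirror s2 C2 ->
  take n./2.+1 s1 = take n./2.+1 s2 -> s1 = s2.
Proof.
move=> n_gt0 size1 size2 mir1 mir2 eq_take.
have eq_nth i : (i <= n./2)%N -> nth 0%N s1 i = nth 0%N s2 i.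
  by move=> le_i; rewrite -(@nth_take n./2.+1) // eq_take nth_take.
rewrite /mirror size1 in mir1; rewrite /mirror size2 in mir2.
have eqC : C1 = C2.
  have lt_mid : (n./2 < n)%N by lia.
  by rewrite -(mir1 _ lt_mid) -(mir2 _ lt_mid) !eq_nth //; lia.
apply: (@eq_from_nth _ 0%N) => [|i]; rewrite size1 // => lt_i.
have [/eq_nth //|gt_i] := leqP i n./2.
have := mir1 _ lt_i; have := mir2 _ lt_i; rewrite (eq_nth (n - i.+1)%N) ?eqC; lia.
Qed.

Section UnfoldHalf.
Variables (n : nat) (t : seq nat).
Hypotheses (n_gt0 : (0 < n)%N) (size_t : size t = n./2.+1)
  (t_path : path leq 1 t).
Let s := unfold_half n t.
Let C := (nth 0 t n./2 + nth 0 t (n - n./2.+1))%N.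

Let t_mono i j : (i <= j <= n./2)%N -> (nth 0 t i <= nth 0 t j)%N.
Proof.
case/andP=> le_ij le_j.
by apply: (sorted_leq_nth leq_trans leqnn 0%N (path_sorted t_path)); rewrite ?inE; lia.
Qed.

Lemma size_unfold_half : size s = n. Proof. by rewrite size_mkseq. Qed.

Lemma take_unfold_half : take n./2.+1 s = t.
Proof.
apply: (@eq_from_nth _ 0%N) => [|i]; rewrite size_takel ?size_unfold_half ?size_t //; try lia.
by move=> lt_i; rewrite nth_take // nth_mkseq -1?ltnS ?lt_i //; lia.
Qed.

Lemma mirror_unfold_half : mirror s C.
Proof.
move=> i; rewrite size_unfold_half => lt_i; rewrite !nth_mkseq; [|lia..].
rewrite -/C subnSK // subKn; last lia.
have t_le k : (k <= n./2)%N -> (nth 0 t k <= C)%N.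
  by move=> le_k; rewrite (leq_trans (@t_mono k n./2 _)) ?leq_addr ?le_k /=.
have [le_i|gt_i] := leqP i n./2; have [le_i'|gt_i'] := leqP (n - i.+1) n./2.
- (* Both indices lie in the first half only for the central pair. *)
  have [->|->] : i = n./2 \/ i = (n - n./2.+1)%N by lia.
    by [].
  by rewrite addnC subnSK ?subKn //; lia.
- by rewrite subnKC // t_le.
- by rewrite subnK // t_le.
- lia.
Qed.

Lemma path_unfold_half : path leq 1 s.
Proof.
have head_t : (1 <= nth 0 t 0)%N by case: t t_path size_t => //= y u /andP[].
have s_sorted : sorted leq s.
  apply/(sortedP 0%N) => i; rewrite size_unfold_half => lt_i.
  rewrite !nth_mkseq; [|lia..]; rewrite -/C.
  have [le_i|gt_i] := leqP i.+1 n./2; first by rewrite (ltnW le_i) t_mono //; lia.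
  have [le_i|gt_i'] := leqP i n./2.
    (* At the junction, [t_h <= t_h + t_(n-1-h) - t_(n-2-h)]. *)
    have -> : i = n./2 by lia.
    by rewrite /C; have := @t_mono (n - n./2.+2) (n - n./2.+1); lia.
  by rewrite leq_sub2l // t_mono //; lia.
case def_s: s s_sorted => [//|y u] /= ->.
by rewrite andbT -[y]/(nth 0 (y :: u) 0)%N -def_s nth_mkseq.
Qed.

End UnfoldHalf.

(** The reflection recovers a palindromic-gap partition from its first half, and
any half extends by reflection; the weights agree because twice the weight is
[n] times the sum of the two central parts ([sumn_half]). *)
Lemma take_half_bij n j : (0 < n)%N ->
  set_bij (pal_slice n j) (chains (half_weights n) j) (take n./2.+1).
Proof.
move=> n_gt0.
have pal_mirror s : Ppal s -> path leq 1 s /\ exists C, mirror s C.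
  case=> s_part s_gap; rewrite -is_partition_path; split=> //.
  by apply/palindromic_gap_mirror => //; case/andP: s_part.
split.
- move=> s [/pal_mirror[s_path [C s_mir]] size_s sum_s]; split.
  + by rewrite size_half_weights // size_takel // size_s; lia.
  + by rewrite take_path.
  + by rewrite -(sumn_half n_gt0 size_s s_mir).
- move=> s1 s2 /set_mem[/pal_mirror[_ [C1 mir1]] size1 _].
  move=> /set_mem[/pal_mirror[_ [C2 mir2]] size2 _].
  exact: take_half_inj mir1 mir2.
- move=> t [size_t t_path t_dot]; rewrite size_half_weights // in size_t.
  have s_mir := mirror_unfold_half n_gt0 size_t t_path.
  have s_size := size_unfold_half n t.
  exists (unfold_half n t); last exact: take_unfold_half.
  split=> //; last first.
    by rewrite (sumn_half n_gt0 s_size s_mir) take_unfold_half.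
  have s_part : is_partition (unfold_half n t).
    by rewrite is_partition_path path_unfold_half.
  split=> //; apply/palindromic_gap_mirror; first by case/andP: s_part.
  by exists (nth 0 t n./2 + nth 0 t (n - n./2.+1))%N.
Qed.

(** The empty partition has no half: it is the only case outside
[take_half_bij]. *)
Lemma pal_slice0 j : pal_slice 0 j = if j == 0%N then [set [::]] else set0.
Proof.
case: eqP => [->|j_neq0]; apply/seteqP; split=> s //=.
- by case=> _ /size0nil.
- by move=> ->; split=> //; split=> // i /=; rewrite leqn0; case: i.
- by case=> _ /size0nil -> /esym.
Qed.

Lemma finite_pal_slice n j : finite_set (pal_slice n j).
Proof.
case: n => [|n]; first by rewrite pal_slice0; case: eqP.
have [take_fun take_inj _] := @take_half_bij n.+1 j isT.
have [f] : $|{injfun pal_slice n.+1 j >-> chains (half_weights n.+1) j}|.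
  by apply/injfunPex; exists (take n.+1./2.+1).
exact: card_le_finite (inj_card_le f) (finite_chains j (last_half_weights _)).
Qed.

Lemma card_pal_slice n j : (0 < n)%N ->
  \sum_(s \in pal_slice n j) (1 : int) = fps_coef (chain_gf (half_weights n)) j.
Proof.
move=> n_gt0 /=; apply: esym.
exact: (reindex_fsbig (take n./2.+1) _ _ _ (take_half_bij j n_gt0)).
Qed.

(** * Series in two variables *)

Lemma coef_zq_monomial a (f : fps int) i j :
  coef_zq (z ^+ a * fpsC f) i j = if i == a then fps_coef f j else 0.
Proof.
rewrite /coef_zq /z coef_fpsXnM.
have [->|neq_ia] := eqVneq i a; first by rewrite leqnn subnn.
by case: leqP => //= le_ai; rewrite ifF //; lia.
Qed.

Lemma qXn n : q ^+ n = fpsC (fpsX int ^+ n).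
Proof. by rewrite /q -rmorphXn. Qed.

Lemma coef_zq_pal_term a b i j :
  coef_zq (z ^+ a * q ^+ b) i j = ((i == a) && (j == b))%:R.
Proof.
rewrite qXn coef_zq_monomial -[_ ^+ b]mulr1 coef_fpsXnM /=.
case: eqP => //= _; case: (ltngtP j b) => [//|lt_bj|->]; last by rewrite subnn.
by rewrite ifF //; lia.
Qed.

Lemma one_sub_qXn n : 1 - q ^+ n = fpsC (1 - fpsX int ^+ n).
Proof. by rewrite qXn rmorphB rmorph1. Qed.

Lemma odd_termE m :
  z ^+ (2 * m + 1) * q ^+ (2 * m + 1) / (1 - q ^+ (2 * m + 1)) ^+ (m + 1)
  = z ^+ (2 * m + 1) * fpsC (chain_gf (half_weights (2 * m + 1))).
Proof.
apply: (canLR (mulrK _)); first by rewrite unitrX // unit_1subq // addn1.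
rewrite one_sub_qXn qXn -mulrA; congr (_ * _).
by rewrite -rmorphXn -rmorphM [X in _ = _ X]mulrC chain_gf_odd.
Qed.

Lemma even_termE m : (0 < m)%N ->
  z ^+ (2 * m) * q ^+ (2 * m) / ((1 - q ^+ (2 * m)) ^+ m * (1 - q ^+ m))
  = z ^+ (2 * m) * fpsC (chain_gf (half_weights (2 * m))).
Proof.
move=> m_gt0; apply: (canLR (mulrK _)).
  by rewrite unitrM unitrX unit_1subq // muln_gt0.
rewrite !one_sub_qXn qXn -mulrA; congr (_ * _).
by rewrite -rmorphXn -!rmorphM [X in _ = _ X]mulrC chain_gf_even.
Qed.

(** Both families on the right-hand side have at most one term in each degree in
[z], so a coefficient of their sum is a coefficient of one term. *)
Section SumByDegree.
Variables (A : set nat) (h : nat -> nat) (G : nat -> fps int).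
Variable (F : nat -> fps_zq).
Hypotheses (h_inj : injective h)
  (F_def : forall m, A m -> F m = z ^+ h m * fpsC (G (h m))).

Lemma summable_by_degree : summable_zq A F.
Proof.
move=> i j; apply: (@sub_finite_set _ _ (A `&` h @^-1` [set i])).
  move=> m [Am] /=; rewrite F_def // coef_zq_monomial.
  by case: (eqVneq i (h m)) => [->|_]; rewrite ?eqxx.
apply: finite_setIr; apply: finite_preimage => // m1 m2 _ _; exact: h_inj.
Qed.

Lemma coef_sum_by_degree m j : A m ->
  coef_zq (sum_zq A F) (h m) j = fps_coef (G (h m)) j.
Proof.
move=> Am; rewrite /coef_zq /sum_zq /=.
rewrite -(@fsbig_widen _ _ _ _ [set m]) => [|_ -> //|k [Ak /= k_neq]].
  by rewrite fsbig_set1 F_def // coef_zq_monomial eqxx.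
rewrite F_def // coef_zq_monomial ifF //; apply/eqP => /h_inj k_eq.
exact: k_neq.
Qed.

Lemma coef_sum_by_degree0 i j : (forall m, A m -> h m != i) ->
  coef_zq (sum_zq A F) i j = 0.
Proof.
move=> h_neq; rewrite /coef_zq /sum_zq /=; apply: fsbig1 => m Am.
by rewrite F_def // coef_zq_monomial eq_sym (negbTE (h_neq m Am)).
Qed.

End SumByDegree.

Lemma coef_sum_pal i j :
  coef_zq (sum_zq Ppal (fun s => z ^+ size s * q ^+ sumn s)) i j
  = \sum_(s \in pal_slice i j) (1 : int).
Proof.
rewrite /coef_zq /sum_zq /=.
rewrite -(@fsbig_widen _ _ _ _ (pal_slice i j)) => [|s []//|s [Ps s_nslice] /=].
  apply: eq_fsbigr => s /set_mem[_ size_s sum_s].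
  by rewrite [LHS]coef_zq_pal_term size_s sum_s !eqxx.
rewrite coef_zq_pal_term; case: andP => // -[/eqP size_s /eqP sum_s].
by case: s_nslice.
Qed.

Lemma summable_pal : summable_zq Ppal (fun s => z ^+ size s * q ^+ sumn s).
Proof.
move=> i j; apply: sub_finite_set (finite_pal_slice i j) => s [Ps] /=.
by rewrite coef_zq_pal_term; case: andP => // -[/eqP size_s /eqP sum_s] _.
Qed.

Theorem corollary2 :
  let pal_term (s : seq nat) : fps_zq := z ^+ size s * q ^+ sumn s in
  let odd_term (m : nat) : fps_zq :=
    z ^+ (2 * m + 1) * q ^+ (2 * m + 1) / (1 - q ^+ (2 * m + 1)) ^+ (m + 1) in
  let even_term (m : nat) : fps_zq :=
    z ^+ (2 * m) * q ^+ (2 * m) / ((1 - q ^+ (2 * m)) ^+ m * (1 - q ^+ m)) in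
  [/\ summable_zq Ppal pal_term,
      summable_zq setT odd_term,
      summable_zq [set m | (1 <= m)%N] even_term
    & sum_zq Ppal pal_term
      = 1 + sum_zq setT odd_term
          + sum_zq [set m | (1 <= m)%N] even_term].
Proof.
move=> pal_term odd_term even_term.
pose G n := chain_gf (half_weights n).
have odd_inj : injective (fun m => 2 * m + 1)%N by move=> m1 m2 /=; lia.
have even_inj : injective (fun m => 2 * m)%N by move=> m1 m2 /=; lia.
have odd_def m : setT m -> odd_term m = z ^+ (2 * m + 1) * fpsC (G (2 * m + 1)%N).
  by move=> _; apply: odd_termE.
have even_def m : [set m | (1 <= m)%N] m ->
    even_term m = z ^+ (2 * m) * fpsC (G (2 * m)%N).
  exact: even_termE.
split; [exact: summable_pal | exact: summable_by_degree odd_inj odd_def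
  | exact: summable_by_degree even_inj even_def |].
apply: fpsP => i; apply: fpsP => j.
rewrite -[LHS]/(coef_zq _ i j) coef_sum_pal.
rewrite [RHS](_ : _ = coef_zq 1 i j + coef_zq (sum_zq setT odd_term) i j
  + coef_zq (sum_zq [set m | (1 <= m)%N] even_term) i j) //.
have coef1 : coef_zq 1 i j = ((i == 0) && (j == 0))%N%:R.
  by rewrite -coef_zq_pal_term mulr1.
rewrite {}coef1; case: (posnP i) => [->|i_gt0].
  rewrite (coef_sum_by_degree0 odd_def); last by move=> m _; lia.
  rewrite (coef_sum_by_degree0 even_def); last by move=> m /=; lia.
  rewrite !addr0 pal_slice0.
  by case: eqP => _; rewrite (fsbig_set1, fsbig_set0).
rewrite card_pal_slice // add0r.
have [odd_i|even_i] := boolP (odd i).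
  rewrite (coef_sum_by_degree0 even_def) ?addr0; last by move=> m /=; lia.
  have -> : i = (2 * i./2 + 1)%N by lia.
  by rewrite (coef_sum_by_degree odd_inj odd_def).
rewrite (coef_sum_by_degree0 odd_def) ?add0r; last by move=> m _; lia.
have def_i : i = (2 * i./2)%N by lia.
rewrite [in RHS]def_i (coef_sum_by_degree even_inj even_def) -?def_i //=; lia.
Qed.
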